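(* There exists an absolute constant $c>0$ such that the following holds. Let $N,d,p$ be positive integers, $\Omega\subseteq\mathbb{R}^d$, and $\sigma:\mathbb{C}\to\mathbb{C}$ any activation function. Let $f_\theta:\Omega^N\to\mathbb{C}$ be a tensor neural network (TNN) with any fixed finite depths and widths of its subnetworks, activation function $\sigma$, and any network parameters $\theta$. If $f_\theta$ is antisymmetric and not identically zero, then its TPF rank with respect to the associated finite-dimensional space $\tilde{\mathcal{F}}(\Omega)$ (defined in the context) satisfies $$\mathrm{rank}_{\tilde{\mathcal{F}}(\Omega)}(f_\theta)\ \ge\ c\,\frac{2^N}{\sqrt{N}}.$$
   Context: All functions are complex-valued. A TNN is a function $$f_\theta(r)=\sum_{i=1}^p\prod_{j=1}^N\Big(\prod_{k=1}^d\psi_{ijk}(r_{jk};\theta_{jk})\Big),\qquad r=(r_1,\dots,r_N)\in\Omega^N,\ r_j=(r_{j1},\dots,r_{jd})^\top,$$ where for each pair $(j,k)$ the vector $(\psi_{1jk},\dots,\psi_{pjk})$ is the output of a fully connected feedforward subnetwork with scalar input $r_{jk}$, parameters $\theta_{jk}$ (complex weights and biases), at least one hidden layer, finite depth and finite widths, and activation $\sigma$ applied componentwise in every hidden layer; the output layer is affine. Thus, writing $h_{jk1},\dots,h_{jkm_{jk}}$ for the (scalar-input) functions computed by the units of the last hidden layer of subnetwork $(j,k)$, $\psi_{ijk}(s;\theta_{jk})=\sum_{\ell=1}^{m_{jk}}a_{ijk\ell}h_{jk\ell}(s)+c_{ijk}$ with $a_{ijk\ell},c_{ijk}\in\mathbb{C}$.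 For the given parameters, $\tilde{\mathcal{F}}(\Omega)$ is the finite-dimensional linear span of the functions $\hat r=(\hat r_1,\dots,\hat r_d)^\top\mapsto\prod_{k\in\mathcal{I}}h_{tk\ell_k}(\hat r_k)$ on $\Omega$, over all $t\in\{1,\dots,N\}$, $\mathcal{I}\subseteq\{1,\dots,d\}$, and $\ell_k\in\{1,\dots,m_{tk}\}$ for $k\in\mathcal{I}$ (for $\mathcal{I}=\emptyset$ the function is identically $1$). Then $f_\theta\in\bigotimes^N\tilde{\mathcal{F}}(\Omega)$. For a linear space $\mathcal{B}$ of functions on $\Omega$, $\bigotimes^N\mathcal{B}$ is the set of all functions on $\Omega^N$ of the form $f=\sum_{i=1}^q\bigotimes_{j=1}^N\psi_{ij}$ with $q\in\mathbb{N}$, $\psi_{ij}\in\mathcal{B}$, where $(\bigotimes_{j=1}^N\psi_j)(r_1,\dots,r_N)=\prod_{j=1}^N\psi_j(r_j)$. The TPF (tensor product function) rank $\mathrm{rank}_{\mathcal{B}}(f)$ is the minimum such $q$. A function $f$ on $\Omega^N$ is antisymmetric if $f(r_1,\dots,r_N)=\mathrm{sgn}(\pi)f(r_{\pi(1)},\dots,r_{\pi(N)})$ for all permutations $\pi$ of $\{1,\dots,N\}$ and all $(r_1,\dots,r_N)\in\Omega^N$. *)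

(* Defs.v *)
From HB Require Import structures.
From mathcomp Require Import all_boot all_order all_algebra.
From mathcomp Require Import perm.
From mathcomp Require Import complex.
From mathcomp Require Import boolp classical_sets functions reals.

Set Implicit Arguments.
Unset Strict Implicit.
Unset Printing Implicit Defensive.

Import Order.TTheory GRing.Theory Num.Theory.
Local Open Scope classical_set_scope.
Local Open Scope ring_scope.
Local Open Scope complex_scope.

Section TensorProductFunctions.
Variables (C : fieldType) (T : Type).
Implicit Types (B G : set (T -> C)) (N q : nat).

Definition lin_span G : set (T -> C) :=
  [set g | exists n (a : 'I_n -> C) (u : 'I_n -> T -> C),
    (forall i, G (u i)) /\ forall x, g x = \sum_(i < n) a i * u i x].

Definition tpf_decomposition B N (f : ('I_N -> T) -> C) q : Prop :=
  exists psi : 'I_q -> 'I_N -> T -> C,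
    (forall i j, B (psi i j)) /\
    forall r, f r = \sum_(i < q) \prod_(j < N) psi i j (r j).

(* The default value 0 is taken when [f] is outside the tensor space; a
   positive lower bound on [tpf_rank B f] thus entails that [f] lies in it. *)
Definition tpf_rank B N (f : ('I_N -> T) -> C) : nat :=
  xget 0%N [set q | tpf_decomposition B f q /\
                    forall q', tpf_decomposition B f q' -> (q <= q')%N].

Definition antisymmetric_fun N (f : ('I_N -> T) -> C) : Prop :=
  forall (pi : 'S_N) (r : 'I_N -> T), f r = (-1) ^+ pi * f (fun j => r (pi j)).

End TensorProductFunctions.

Section TensorNeuralNetworks.
Variable C : fieldType.

(* Weights and biases of a nonempty chain of hidden layers of positive widths
   with scalar input; the index is the width of the last layer. *)
Inductive hidden_layers : nat -> Type :=
| FirstLayer m of (0 < m)%N & 'cV[C]_m & 'cV[C]_m : hidden_layers m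
| NextLayer n m of hidden_layers n & (0 < m)%N & 'M[C]_(m, n) & 'cV[C]_m :
    hidden_layers m.

Fixpoint hidden_output (sigma : C -> C) m (H : hidden_layers m) (s : C) :
    'cV[C]_m :=
  match H with
  | FirstLayer _ _ W b => map_mx sigma (s *: W + b)
  | NextLayer _ _ H' _ W b => map_mx sigma (W *m hidden_output sigma H' s + b)
  end.

Record subnetwork (p : nat) := Subnetwork {
  last_width : nat;
  hidden : hidden_layers last_width;
  out_weights : 'M[C]_(p, last_width);
  out_biases : 'cV[C]_p
}.

Definition last_unit sigma p (S : subnetwork p) (l : 'I_(last_width S)) (s : C)
  : C := hidden_output sigma (hidden S) s l 0.

Definition subnetwork_output sigma p (S : subnetwork p) (i : 'I_p) (s : C) : C :=
  (out_weights S *m hidden_output sigma (hidden S) s + out_biases S) i 0.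

End TensorNeuralNetworks.

Section TNN.
Variables (R : realType) (N d p : nat) (Omega : set 'cV[R]_d).
Variables (sigma : R[i] -> R[i]) (theta : 'I_N -> 'I_d -> subnetwork R[i] p).

Definition tnn (r : 'I_N -> Omega) : R[i] :=
  \sum_(i < p) \prod_(j < N) \prod_(k < d)
    subnetwork_output sigma (theta j k) i (\val (r j) k 0)%:C.

(* Units [l k] are chosen for every [k], but only those with [k \in I] matter;
   such a total choice always exists since widths are positive. *)
Definition tnn_generators : set (Omega -> R[i]) :=
  [set g | exists (t : 'I_N) (I : {set 'I_d})
                  (l : forall k, 'I_(last_width (theta t k))),
    forall x : Omega,
      g x = \prod_(k in I) last_unit sigma (l k) (\val x k 0)%:C].

Definition tnn_space : set (Omega -> R[i]) := lin_span tnn_generators.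

End TNN.

Arguments tnn {R N d p} Omega sigma theta r.
Arguments tnn_generators {R N d p} Omega sigma theta g.
Arguments tnn_space {R N d p} Omega sigma theta g.

(* Main.v *)
Require Import Defs.
From HB Require Import structures.
From mathcomp Require Import all_boot all_order all_algebra.
From mathcomp Require Import perm.
From mathcomp Require Import complex.
From mathcomp Require Import boolp classical_sets functions reals.
From mathcomp Require Import zify.

Set Implicit Arguments.
Unset Strict Implicit.
Unset Printing Implicit Defensive.

Import Order.TTheory GRing.Theory Num.Theory.
Local Open Scope classical_set_scope.
Local Open Scope ring_scope.
Local Open Scope complex_scope.

(** The bound holds for the rank over any space of factors, because it already
holds for the number [q] of terms in a decomposition
[f r = \sum_(i < q) \prod_j psi i j (r j)] with arbitrary [psi i j].

Fix [r] with [f r != 0] and put [k = N./2].  Call the first [k] slots the left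
half and the others the right half.  For two [k]-subsets [K] and [L] of the
indices, fill the left half with the points [r j], [j \in K], and the right half
with the points [r j], [j \notin L].  If [K = L], every point of [r] is used
once, so the value of [f] is [f r] up to sign.  If [K != L], then some point of
[K] outside [L] occurs in both halves, so [f] vanishes there by antisymmetry.
The resulting square matrix indexed by ['C(N, k)] subsets is thus diagonal
without zeros on the diagonal; but separating the two halves in each term of
the decomposition factors it through a space of dimension [q].  Hence
['C(N, k) <= q] ([antisymmetric_decomposition_size]).

The middle binomial coefficient satisfies [4 ^ N <= 4 * N * 'C(N, N./2) ^ 2]
([middle_bin_lower_bound]), which gives the constant [1 / 2].

A rank equal to the default value [0] must still be excluded: expanding
the products of affine output units shows that the network is a sum of [p]
elementary products over its space ([tnn_decomposition]), so that the minimum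
defining the rank is attained. *)

(** * The middle binomial coefficient *)

Lemma central_binS n :
  (n.+1 * 'C(n.+1.*2, n.+1) = 2 * (n.*2.+1 * 'C(n.*2, n)))%N.
Proof.
have down := mul_bin_down n.*2.+1 n; have diag := mul_bin_diag n.+1.*2 n.
rewrite /= in down diag.
have e : (n.*2.+1 - n = n.+1)%N by lia.
by rewrite e in down; rewrite down -diag doubleS -muln2; lia.
Qed.

(** Passing from [n] to [n.+1] multiplies the square of the central coefficient
by [(2 (2 n + 1) / (n + 1)) ^ 2], hence the right-hand side by
[4 (2 n + 1) ^ 2 / (n (n + 1))], which exceeds [16]. *)
Lemma central_bin_lower_bound n :
  (0 < n)%N -> (16 ^ n <= 4 * n * 'C(n.*2, n) ^ 2)%N.
Proof.
elim: n => // -[_ _ //|n IH] _; have {IH} := IH isT.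
have := central_binS n.+1; rewrite [(16 ^ n.+2)%N]expnS.
move: n.+1 => {}n; move: 'C(_, _) 'C(_, _) (16 ^ _)%N => a b u step IH.
rewrite -(leq_pmul2l (ltn0Sn n)).
have -> : (n.+1 * (4 * n.+1 * b ^ 2) = 4 * (n.+1 * b) ^ 2)%N by lia.
rewrite step (_ : 4 * _ = 16 * (4 * n * n.+1).+1 * a ^ 2)%N; last by lia.
by nia.
Qed.

(** For odd [N = 2 n + 1] the middle coefficient is half of the next central one,
and the bound for [N + 1] loses only the factor [2 (N + 1) / (4 N) <= 1]. *)
Lemma middle_bin_lower_bound N :
  (0 < N)%N -> (4 ^ N <= 4 * N * 'C(N, N./2) ^ 2)%N.
Proof.
rewrite -{1 2 3 4}(odd_double_half N); move: (odd N) N./2 => b n.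
case: b => [_|/=]; last first.
  rewrite add0n double_gt0 => /central_bin_lower_bound le16.
  by rewrite -mul2n expnM mul2n (leq_trans le16)//; lia.
have := central_bin_lower_bound (ltn0Sn n).
have dbl : ('C(n.+1.*2, n.+1) = 2 * 'C(n.*2.+1, n))%N.
  apply/eqP; rewrite -(eqn_pmul2l (ltn0Sn n)) -mul_bin_diag /=.
  by apply/eqP; lia.
rewrite dbl add1n (_ : 16 ^ n.+1 = 4 * 4 ^ n.*2.+1)%N.
  by lia.
by rewrite -expnS -doubleS -mul2n expnM.
Qed.

(** * Antisymmetric functions have long decompositions *)

(** List [A] and then its complement, list [B] and then its complement; matching
the two lists position by position is the required permutation. *)
Lemma exists_perm_onto (T : finType) (A B : {set T}) :
  #|A| = #|B| -> exists s : {perm T}, forall x, (s x \in B) = (x \in A).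
Proof.
move=> cardAB; pose e (D : {set T}) := enum D ++ enum (~: D).
have mem_e D x : x \in e D by rewrite mem_cat !mem_enum finset.in_setC orbN.
have uniq_e D : uniq (e D).
  rewrite cat_uniq !enum_uniq andbT /=; apply/hasPn => x.
  by rewrite !mem_enum finset.in_setC.
have size_e D : size (e D) = #|T| by rewrite size_cat -!cardE cardsC.
have lt_index x : (index x (e A) < size (e B))%N.
  by rewrite size_e -(size_e A) index_mem.
pose f x := nth x (e B) (index x (e A)).
have inj_f : injective f.
  move=> x y; rewrite /f (set_nth_default y)// => /eqP.
  by rewrite nth_uniq// => /eqP /(congr1 (nth x (e A))); rewrite !nth_index.
exists (perm inj_f) => x.
rewrite permE /f index_cat mem_enum nth_cat -cardE -cardAB.
case: (boolP (x \in A)) => xA.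
  rewrite {1}cardE index_mem mem_enum xA -(mem_enum B).
  by rewrite mem_nth// -cardE -cardAB cardE index_mem mem_enum.
rewrite -cardE ltnNge leq_addr /= addKn.
apply: negbTE; rewrite -finset.in_setC -(mem_enum (~: B)) mem_nth// -cardE.
have <- : #|~: A| = #|~: B| by have := cardsC A; have := cardsC B; lia.
by rewrite cardE index_mem mem_enum finset.in_setC.
Qed.

(** After division by its diagonal entries the matrix of the sums is the identity,
which factors only through dimensions at least its size. *)
Lemma factorized_family_card (F : fieldType) (I : finType) q
    (u v : I -> 'I_q -> F) :
  (forall x y, (\sum_i u x i * v y i != 0) = (x == y)) -> (#|I| <= q)%N.
Proof.
move=> diag; pose g (x : I) := \sum_i u x i * v x i.
pose A : 'M[F]_(#|I|, q) := \matrix_(a, i) u (enum_val a) i.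
pose B : 'M[F]_(q, #|I|) :=
  \matrix_(i, b) (v (enum_val b) i / g (enum_val b)).
apply: (@mulmx1_min _ _ _ A B); apply/matrixP => a b; rewrite !mxE.
under eq_bigr do rewrite !mxE mulrA.
rewrite -mulr_suml; have := diag (enum_val a) (enum_val b).
rewrite (inj_eq enum_val_inj); case: (eqVneq a b) => [<- nz|_ /negbFE/eqP ->].
  by rewrite mulfV.
by rewrite mul0r.
Qed.

Section Antisymmetric.
Variables (F : fieldType) (T : Type) (N : nat) (f : ('I_N -> T) -> F).
Hypothesis f_anti : antisymmetric_fun f.

Lemma antisymmetric_perm_eq0 (s : 'S_N) r : (f (r \o s) == 0) = (f r == 0).
Proof. by rewrite (f_anti s r) mulf_eq0 signr_eq0. Qed.

Lemma antisymmetric_repeat (r : 'I_N -> T) i j :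
  2%:R != 0 :> F -> i != j -> r i = r j -> f r = 0.
Proof.
move=> nz2 ij rij; have := f_anti (tperm i j) r.
have -> : (fun k => r (tperm i j k)) = r.
  by apply/funext => k; case: tpermP => // ->.
rewrite odd_tperm ij expr1 mulN1r => /eqP; rewrite -addr_eq0 -mulr2n -mulr_natr.
by rewrite mulf_eq0 (negbTE nz2) orbF => /eqP.
Qed.

(** The [k]-subset [K] is encoded by a permutation [s K] sending the first [k]
slots [P] onto [K]; then [g] agrees with [s K] on [P] and with [s L] off [P], so
it is a permutation when [K = L] and takes some value twice otherwise. *)
Lemma antisymmetric_decomposition_size (B : set (T -> F)) q k r :
    2%:R != 0 :> F -> (k <= N)%N -> f r != 0 -> tpf_decomposition B f q ->
  ('C(N, k) <= q)%N.
Proof.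
move=> nz2 kN fr [psi [_ fE]].
pose P := [set j : 'I_N | (j < k)%N]%SET.
pose X : finType := {K : {set 'I_N} | #|K| == k}.
have cardP : #|P| = k.
  by rewrite cardsE -sum1_card (big_ord_narrow kN) sum1_card card_ord.
have /choice[s sP] (K : X) :
    exists t : 'S_N, forall j, (t j \in val K) = (j \in P).
  by apply: exists_perm_onto; rewrite cardP (eqP (valP K)).
have <- : #|X| = 'C(N, k).
  rewrite card_sig -[in RHS](card_ord N) -card_draws [RHS]cardsE.
  exact: eq_card.
apply: (@factorized_family_card F X q
  (fun K i => \prod_(j in P) psi i j (r (s K j)))
  (fun L i => \prod_(j in ~: P) psi i j (r (s L j)))) => K L.
pose g j := if j \in P then s K j else s L j.
have -> : \sum_i (\prod_(j in P) psi i j (r (s K j))) *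
    (\prod_(j in ~: P) psi i j (r (s L j))) = f (r \o g).
  rewrite fE; apply: eq_bigr => i _.
  rewrite [RHS](bigID (fun j => j \in P)) /=; congr (_ * _).
    by apply: eq_bigr => j jP; rewrite /g jP.
  apply: eq_big => [j|j]; rewrite finset.in_setC// => /negbTE jP.
  by rewrite /g jP.
case: (eqVneq K L) => [eqKL|neqKL].
  have -> : g = s L by apply/funext => j; rewrite /g eqKL if_same.
  by rewrite antisymmetric_perm_eq0.
have /subsetPn[x xK xL] : ~~ (val K \subset val L).
  apply: contra neqKL => KL; apply/eqP/val_inj/eqP.
  by rewrite eqEcard KL (eqP (valP K)) (eqP (valP L)) leqnn.
(* [x] fills a slot in [P] through [s K] and a slot off [P] through [s L]. *)
pose a := (s K)^-1%g x; pose b := (s L)^-1%g x.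
have aP : a \in P by rewrite -(sP K) permKV.
have bP : b \notin P by rewrite -(sP L) permKV.
apply/negbF/eqP/(@antisymmetric_repeat _ a b nz2).
  by apply: contraNneq bP => <-.
by rewrite /= /g aP (negbTE bP) !permKV.
Qed.

End Antisymmetric.

(** * Linear spans and products of affine combinations *)

Section LinSpan.
Variables (F : fieldType) (T : Type).
Implicit Types (G : set (T -> F)) (g : T -> F).

Lemma lin_span_gen G g : G g -> lin_span G g.
Proof.
move=> Gg; exists 1%N, (fun=> 1), (fun=> g); split=> // x.
by rewrite big_ord1 mul1r.
Qed.

Lemma lin_span0 G : lin_span G (fun=> 0).
Proof.
by exists 0%N, (fun=> 0), (fun _ _ => 0); split=> [[]|x]//; rewrite big_ord0.
Qed.

Lemma lin_spanD G g1 g2 : lin_span G g1 -> lin_span G g2 ->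
  lin_span G (fun x => g1 x + g2 x).
Proof.
move=> [n1 [a1 [u1 [Gu1 E1]]]] [n2 [a2 [u2 [Gu2 E2]]]].
pose glue S (b1 : 'I_n1 -> S) (b2 : 'I_n2 -> S) (i : 'I_(n1 + n2)) :=
  match fintype.split i with inl j => b1 j | inr j => b2 j end.
exists (n1 + n2)%N, (glue _ a1 a2), (glue _ u1 u2); split=> [i|x].
  by rewrite /glue; case: fintype.split.
rewrite big_split_ord /= E1 E2.
have glueK := @unsplitK n1 n2.
congr (_ + _); apply: eq_bigr => i _; rewrite /glue.
  by rewrite (glueK (inl i)).
by rewrite (glueK (inr i)).
Qed.

Lemma lin_spanZ G c g : lin_span G g -> lin_span G (fun x => c * g x).
Proof.
move=> [n [a [u [Gu E]]]]; exists n, (fun i => c * a i), u; split=> // x.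
by rewrite E mulr_sumr; apply: eq_bigr => i _; rewrite mulrA.
Qed.

Lemma lin_span_sum G (I : Type) (s : seq I) (u : I -> T -> F) :
  (forall i, lin_span G (u i)) -> lin_span G (fun x => \sum_(i <- s) u i x).
Proof.
move=> Gu; elim: s => [|i s IH].
  by under eq_fun do rewrite big_nil; exact: lin_span0.
by under eq_fun do rewrite big_cons; exact: lin_spanD.
Qed.

Lemma lin_spanM G G' h g :
    (forall u, G u -> lin_span G' (fun x => h x * u x)) ->
  lin_span G g -> lin_span G' (fun x => h x * g x).
Proof.
move=> hG [n [a [u [Gu E]]]].
under eq_fun do rewrite E mulr_sumr.
apply: lin_span_sum => i; under eq_fun do rewrite mulrCA.
exact/lin_spanZ/hG.
Qed.

Lemma lin_spanS G G' g : G `<=` G' -> lin_span G g -> lin_span G' g.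
Proof.
by move=> sub [n [a [u [Gu E]]]]; exists n, a, u; split=> // i; exact/sub.
Qed.

End LinSpan.

Section Products.
Variables (F : fieldType) (T : Type) (K : finType) (w : K -> nat).
Variable h : forall k, 'I_(w k) -> T -> F.

(** The bound [D] on [I] is what an induction on the factors needs: a product over
[I \subset D] leaves the choice [l] free at every [k \notin D], so it can be
multiplied by any unit at such a [k] after overwriting [l] there. *)
Definition partial_products (D : {set K}) : set (T -> F) :=
  [set g | exists (I : {set K}) (l : forall k, 'I_(w k)),
    I \subset D /\ forall x, g x = \prod_(k in I) h (l k) x].

Lemma partial_productsS (D D' : {set K}) :
  D \subset D' -> partial_products D `<=` partial_products D'.
Proof.
move=> DD' g [I [l [ID gE]]]; exists I, l; split=> //.
exact: fintype.subset_trans DD'.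
Qed.

Lemma partial_products_mul (D : {set K}) k m g : k \notin D ->
  partial_products D g -> partial_products (k |: D) (fun x => @h k m x * g x).
Proof.
move=> kD [I [l [ID gE]]]; exists (k |: I), (dfwith l m).
split=> [|x]; first exact: finset.setUS.
have kI : k \notin I by apply: contra kD; exact: (fintype.subsetP ID).
rewrite big_setU1//= dfwith_in gE; congr (_ * _).
apply: eq_bigr => j jI; rewrite dfwith_out//.
by apply: contraNneq kI => ->.
Qed.

(** Distributing one more factor turns each product [u] already obtained into the
products [h m * u], in which the new index has been selected, and into a multiple
of [u] itself, contributed by the constant term. *)
Lemma prod_affine_span (c : K -> F) (a : forall k, 'I_(w k) -> F) (s : seq K) :
    (forall k, 0 < w k)%N -> uniq s ->
  lin_span (partial_products [set k in s]%SET)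
    (fun x => \prod_(k <- s) (\sum_m a k m * h m x + c k)).
Proof.
move=> w_gt0; elim: s => [_|k s IH /= /andP[ks us]].
  apply: lin_span_gen; exists finset.set0, (fun k => Ordinal (w_gt0 k)).
  by split=> [|x]; rewrite ?finset.sub0set// big_nil big_set0.
under [X in lin_span _ X]eq_fun do rewrite big_cons.
apply: lin_spanM (IH us) => u Du.
have -> : [set j in k :: s]%SET = (k |: [set j in s])%SET.
  by apply/finset.setP => j; rewrite !inE.
under [X in lin_span _ X]eq_fun do rewrite mulrDl mulr_suml.
apply: lin_spanD; last first.
  exact/lin_spanZ/lin_span_gen/(partial_productsS (finset.subsetUr _ _)).
apply: lin_span_sum => m; under [X in lin_span _ X]eq_fun do rewrite -mulrA.
apply: lin_spanZ; apply: lin_span_gen; apply: partial_products_mul => //.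
by rewrite inE.
Qed.

End Products.

(** * Tensor neural networks and their rank *)

Lemma hidden_layers_gt0 (C : fieldType) m : hidden_layers C m -> (0 < m)%N.
Proof. by case. Qed.

Lemma tnn_decomposition (R : realType) N d p (Omega : set 'cV[R]_d)
    (sigma : R[i] -> R[i]) (theta : 'I_N -> 'I_d -> subnetwork R[i] p) :
  tpf_decomposition (tnn_space Omega sigma theta) (tnn Omega sigma theta) p.
Proof.
exists (fun i j (x : Omega) =>
  \prod_(k < d) subnetwork_output sigma (theta j k) i (\val x k 0)%:C).
split=> // i j; pose h k m (x : Omega) :=
  last_unit sigma (p := p) (S := theta j k) m (\val x k 0)%:C.
have w_gt0 k : (0 < last_width (theta j k))%N.
  exact/hidden_layers_gt0/hidden.
have -> : (fun x : Omega =>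
    \prod_(k < d) subnetwork_output sigma (theta j k) i (\val x k 0)%:C) =
  (fun x => \prod_(k < d) (\sum_m out_weights (theta j k) i m * h k m x +
    out_biases (theta j k) i 0)).
  by apply/funext => x; apply: eq_bigr => k _; rewrite /subnetwork_output !mxE.
apply: lin_spanS (prod_affine_span h _ _ w_gt0 (index_enum_uniq _)).
by move=> g [I [l [_ gE]]]; exists j, I, l.
Qed.

(** One decomposition suffices for the rank to be a true minimum rather than the
default value [0]. *)
Lemma tpf_rank_ge (C : fieldType) T (B : set (T -> C)) N
    (f : ('I_N -> T) -> C) m q0 :
    tpf_decomposition B f q0 ->
  (forall q, tpf_decomposition B f q -> (m <= q)%N) -> (m <= tpf_rank B f)%N.
Proof.
move=> fq0 lb; rewrite /tpf_rank; apply: lb.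
case: xgetP => [q _ []//|noq]; exfalso.
have ex : exists q, `[< tpf_decomposition B f q >] by exists q0; exact/asboolP.
case: (ex_minnP ex) => q /asboolP fq qmin; apply: (noq q).
by split=> // q' fq'; apply: qmin; exact/asboolP.
Qed.

Theorem corollary3p5 (R : realType) :
  exists c : R, 0 < c /\
    forall (N d p : nat) (Omega : set 'cV[R]_d) (sigma : R[i] -> R[i])
           (theta : 'I_N -> 'I_d -> subnetwork R[i] p),
      (0 < N)%N -> (0 < d)%N -> (0 < p)%N ->
      antisymmetric_fun (tnn Omega sigma theta) ->
      (exists r : 'I_N -> Omega, tnn Omega sigma theta r != 0) ->
      c * (2 ^+ N / Num.sqrt N%:R)
        <= (tpf_rank (tnn_space Omega sigma theta)
                     (tnn Omega sigma theta))%:R.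
Proof.
exists 2^-1; split=> [|N d p Omega sigma theta N_gt0 _ _ anti [r fr]].
  by rewrite invr_gt0 ltr0n.
have rank_ge : ('C(N, N./2) <=
    tpf_rank (tnn_space Omega sigma theta) (tnn Omega sigma theta))%N.
  apply: tpf_rank_ge (tnn_decomposition _ _ _) _ => q.
  apply: (antisymmetric_decomposition_size anti _ _ fr).
    by rewrite pnatr_eq0.
  by rewrite -leq_double; lia.
apply: le_trans (_ : 'C(N, N./2)%:R <= _); last by rewrite ler_nat.
rewrite mulrA ler_pdivrMr ?sqrtr_gt0 ?ltr0n// ler_pdivrMl ?ltr0n//.
rewrite -(@ler_pXn2r _ 2)// ?nnegrE ?mulr_ge0 ?exprn_ge0 ?sqrtr_ge0//.
rewrite !exprMn sqr_sqrtr// exprAC -!natrX -!natrM ler_nat.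
by rewrite (leq_trans (middle_bin_lower_bound N_gt0))// -mulnA [(N * _)%N]mulnC.
Qed.
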